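(* Let $\mathbb{K}$ be an algebraically closed field of characteristic zero and let $H$ be a finite dimensional Hopf algebra over $\mathbb{K}$. If $H$ is almost involutive, then its Drinfel'd double $D(H)$ is almost involutive.
   Context: A Hopf algebra $L$ with antipode $\mathcal{S}$ is almost involutive if there exists a Hopf algebra automorphism $\sigma:L\to L$ with $\sigma^2=\mathcal{S}^2$. For a finite dimensional Hopf algebra $H$ with antipode $\mathcal{S}$, let $H^\vee$ be the dual Hopf algebra and $H^{\vee\mathrm{cop}}$ the same algebra with opposite comultiplication. The Drinfel'd double is the bicrossed product $D(H)=H^{\vee\mathrm{cop}}\bowtie H$ associated with the matched pair $(H^{\vee\mathrm{cop}},H,\triangleleft,\triangleright)$, where for $\alpha\in H^\vee$, $x,y\in H$ (Sweedler notation in $H$), $(x\triangleright\alpha)(y)=\sum\alpha\left(\mathcal{S}^{-1}(x_2)\,y\,x_1\right)$ and $x\triangleleft\alpha=\sum\alpha\left(\mathcal{S}^{-1}(x_3)x_1\right)x_2$. Here, for a matched pair $(A,H,\triangleleft,\triangleright)$, the bicrossed product $A\bowtie H$ is the Hopf algebra with underlying coalgebra $A\otimes H$ and product $(a\otimes x)(b\otimes y)=\sum a(x_1\triangleright b_1)\otimes(x_2\triangleleft b_2)y$, unit $1\otimes 1$. *)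

(* Defs.v *)
From HB Require Import structures.
From mathcomp Require Import all_boot all_order all_algebra.

Set Implicit Arguments.
Unset Strict Implicit.
Unset Printing Implicit Defensive.

Import GRing.Theory.
Local Open Scope ring_scope.

Reserved Notation "v ⊗ w" (at level 40, left associativity).
Reserved Notation "\Sw_ ( a , b <- t ) F"
  (at level 41, a name, b name, F at level 41,
   format "'[' \Sw_ ( a ,  b  <-  t ) '/  '  F ']'").
Reserved Notation "\sw_ ( a , b <- t ) F"
  (at level 41, a name, b name, F at level 41,
   format "'[' \sw_ ( a ,  b  <-  t ) '/  '  F ']'").

Section Tensor.
Variable K : fieldType.
Implicit Types V W U : vectType K.

Definition bas V (i : 'I_(\dim {:V})) : V := (vbasis {:V})`_i.
Definition crd V (i : 'I_(\dim {:V})) : V -> K := coord (vbasis {:V}) i.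

(* V ⊗ W is realised by coordinate matrices: t stands for
   \sum_(i, j) t i j *: (bas i ⊗ bas j). *)
Definition tens V W : vectType K := 'M[K]_(\dim {:V}, \dim {:W}).

Definition ptens V W (v : V) (w : W) : tens V W :=
  \matrix_(i, j) (crd i v * crd j w).

(* For bilinear f, [tlift f] is the linear map V ⊗ W -> U induced by f: see
   tlift_ptens and tens_ind below. *)
Definition tlift V W U (f : V -> W -> U) (t : tens V W) : U :=
  \sum_i \sum_j (t : 'M_(_, _)) i j *: f (bas i) (bas j).

Definition tform V W (f : V -> W -> K) : tens V W -> K := @tlift V W K^o f.

Definition bilinear_map V W U (f : V -> W -> U) : Prop :=
  (forall v, linear (f v)) /\ (forall w, linear (f^~ w)).

Definition vdual V : vectType K := 'Hom(V, K^o).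
Definition ev V (a : vdual V) (v : V) : K := (a : 'Hom(V, K^o)) v.
Definition lform V (f : V -> K) : vdual V := linfun (f : V -> K^o).

End Tensor.

Notation "v ⊗ w" := (ptens v w) : ring_scope.

(* Sweedler notation: for t = \sum_k a_k ⊗ b_k and F bilinear in a and b,
   \Sw_(a, b <- t) F is \sum_k F(a_k, b_k).  With t the coproduct of x it is the
   usual sum over x_1, x_2.  \sw is the same for scalar valued F. *)
Notation "\Sw_ ( a , b <- t ) F" := (tlift (fun a b => F) t) : ring_scope.
Notation "\sw_ ( a , b <- t ) F" := (tform (fun a b => F) t) : ring_scope.

Section TensorTheory.
Variables (K : fieldType) (V W U : vectType K).

Lemma bas_crd (X : vectType K) (v : X) : v = \sum_i crd i v *: bas i.
Proof. exact: coord_vbasis (memvf v). Qed.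

Lemma tlift_linear (f : V -> W -> U) : linear (tlift f).
Proof.
move=> a s t; rewrite /tlift scaler_sumr -big_split; apply: eq_bigr => i _ /=.
rewrite scaler_sumr -big_split; apply: eq_bigr => j _ /=.
by rewrite !mxE scalerDl scalerA.
Qed.

Lemma tlift_ptens (f : V -> W -> U) v w :
  bilinear_map f -> \Sw_(a, b <- v ⊗ w) f a b = f v w.
Proof.
case=> fr fl; rewrite /tlift {2}(bas_crd v) {2}(bas_crd w).
have f0r x : f x 0 = 0.
  by have := fr x (-1) 0 0; rewrite scaler0 addr0 scaleN1r addNr.
have f0l y : f 0 y = 0.
  by have := fl y (-1) 0 0; rewrite /= scaler0 addr0 scaleN1r addNr.
have fsr x n (F : 'I_n -> W) (c : 'I_n -> K) :
    f x (\sum_i c i *: F i) = \sum_i c i *: f x (F i).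
  by elim/big_rec2: _ => [|i y1 y2 _ <-]; rewrite ?f0r // fr.
have fsl y n (F : 'I_n -> V) (c : 'I_n -> K) :
    f (\sum_i c i *: F i) y = \sum_i c i *: f (F i) y.
  by elim/big_rec2: _ => [|i y1 y2 _ <-]; rewrite ?f0l //; apply: fl.
rewrite fsl; apply: eq_bigr => i _; rewrite fsr scaler_sumr.
by apply: eq_bigr => j _; rewrite mxE scalerA.
Qed.

Lemma tens_ind (t : tens V W) : t = \Sw_(v, w <- t) (v ⊗ w).
Proof.
apply/matrixP => i j; rewrite /tlift summxE (bigD1 i) //= summxE (bigD1 j) //=.
have crdE (X : vectType K) (k l : 'I_(\dim {:X})) : crd k (bas l) = (k == l)%:R.
  by rewrite /crd /bas coord_free ?(basis_free (vbasisP _)) // eq_sym.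
rewrite !mxE !crdE !eqxx !mulr1 big1 ?addr0 => [|l /negPf nl].
  rewrite big1 ?addr0 // => k /negPf nk.
  by rewrite summxE big1 // => l _; rewrite !mxE !crdE eq_sym nk mul0r mulr0.
by rewrite !mxE !crdE [j == l]eq_sym nl !mulr0.
Qed.

End TensorTheory.

(* The structure maps alone; the Hopf algebra axioms are [is_hopf]. *)
Record hopfData (K : fieldType) := HopfData {
  hcarrier :> vectType K;
  hmul : hcarrier -> hcarrier -> hcarrier;
  hone : hcarrier;
  hcomul : hcarrier -> tens hcarrier hcarrier;
  hcounit : hcarrier -> K;
  hantip : hcarrier -> hcarrier
}.

Arguments hone {K}.

Declare Scope hopf_scope.
Delimit Scope hopf_scope with H.
Local Open Scope hopf_scope.
Notation "x ∗ y" := (hmul x y) (at level 40, left associativity) : hopf_scope.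
Notation "'Δ' x" := (hcomul x) (at level 10, x at level 9) : hopf_scope.
Notation "'ε' x" := (hcounit x) (at level 10, x at level 9) : hopf_scope.

Section Hopf.
Variable K : fieldType.
Implicit Types H L A : hopfData K.

Record is_algebra H : Prop := IsAlgebra {
  hmul_bilinear : bilinear_map (@hmul K H);
  hmulA : forall x y z : H, x ∗ (y ∗ z) = (x ∗ y) ∗ z;
  hmul1l : forall x : H, hone H ∗ x = x;
  hmul1r : forall x : H, x ∗ hone H = x
}.

Record is_coalgebra H : Prop := IsCoalgebra {
  hcomul_linear : linear (@hcomul K H);
  hcounit_linear : scalar (@hcounit K H);
  hcomulA : forall x : H,
    \Sw_(x1, u <- Δ x) \Sw_(x2, x3 <- Δ u) (x1 ⊗ (x2 ⊗ x3)) =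
    \Sw_(u, x3 <- Δ x) \Sw_(x1, x2 <- Δ u) (x1 ⊗ (x2 ⊗ x3));
  hcounitl : forall x : H, \Sw_(x1, x2 <- Δ x) (ε x1 *: x2) = x;
  hcounitr : forall x : H, \Sw_(x1, x2 <- Δ x) (ε x2 *: x1) = x
}.

Record is_bialgebra H : Prop := IsBialgebra {
  hopf_algebra : is_algebra H;
  hopf_coalgebra : is_coalgebra H;
  hcomulM : forall x y : H,
    Δ (x ∗ y) =
    \Sw_(x1, x2 <- Δ x) \Sw_(y1, y2 <- Δ y) ((x1 ∗ y1) ⊗ (x2 ∗ y2));
  hcomul1 : Δ (hone H) = hone H ⊗ hone H;
  hcounitM : forall x y : H, ε (x ∗ y) = ε x * ε y;
  hcounit1 : ε (hone H) = 1
}.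

Record is_hopf H : Prop := IsHopf {
  hopf_bialgebra : is_bialgebra H;
  hantip_linear : linear (@hantip K H);
  hantipl : forall x : H, \Sw_(x1, x2 <- Δ x) (hantip x1 ∗ x2) = ε x *: hone H;
  hantipr : forall x : H, \Sw_(x1, x2 <- Δ x) (x1 ∗ hantip x2) = ε x *: hone H
}.

Record is_hopf_automorphism L (s : L -> L) : Prop := IsHopfAutomorphism {
  haut_linear : linear s;
  haut_bijective : bijective s;
  hautM : forall x y : L, s (x ∗ y) = s x ∗ s y;
  haut1 : s (hone L) = hone L;
  haut_comul : forall x : L, Δ (s x) = \Sw_(x1, x2 <- Δ x) (s x1 ⊗ s x2);
  haut_counit : forall x : L, ε (s x) = ε x;
  haut_antip : forall x : L, s (hantip x) = hantip (s x)
}.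

(* "L is an almost involutive Hopf algebra": the Hopf axioms are included, since
   [hopfData] does not carry them. *)
Definition almost_involutive L : Prop :=
  is_hopf L /\
  exists2 s : L -> L, is_hopf_automorphism s
                    & forall x : L, s (s x) = hantip (hantip x).

(* The two-sided inverse of the antipode when the latter is bijective, which
   holds for every finite dimensional Hopf algebra. *)
Definition antip_inv H : H -> H := ((linfun (@hantip K H))^-1)%VF.

(* The convolution algebra of linear forms.  The coproduct of a is the element
   of H^∨ ⊗ H^∨ with a (x ∗ y) = \sum a_1 x * a_2 y, written in the dual basis. *)
Definition hdual H : hopfData K :=
  @HopfData K (vdual H)
    (fun a b => lform (fun x : H => \sw_(x1, x2 <- Δ x) (ev a x1 * ev b x2)))
    (lform (@hcounit K H))
    (fun a => \sum_i \sum_j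
       ev a (bas i ∗ bas j) *: (lform (@crd K H i) ⊗ lform (@crd K H j)))
    (fun a => ev a (hone H))
    (fun a => lform (fun x : H => ev a (hantip x))).

(* The opposite coproduct; the antipode is then the inverse of the original. *)
Definition hcop H : hopfData K :=
  @HopfData K H (@hmul K H) (hone H)
    (fun x => \Sw_(x1, x2 <- Δ x) (x2 ⊗ x1)) (@hcounit K H) (@antip_inv H).

Definition bicrossed_mul A H (lact : H -> A -> A) (ract : H -> A -> H)
    (u v : tens A H) : tens A H :=
  \Sw_(a, x <- u) \Sw_(b, y <- v) \Sw_(x1, x2 <- Δ x) \Sw_(b1, b2 <- Δ b)
    ((a ∗ lact x1 b1) ⊗ (ract x2 b2 ∗ y)).

(* The antipode is forced: a ⊗ x = (a ⊗ 1)(1 ⊗ x), the maps a |-> a ⊗ 1 and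
   x |-> 1 ⊗ x are Hopf algebra maps, and antipodes reverse products. *)
Definition bicrossed A H (lact : H -> A -> A) (ract : H -> A -> H) :
    hopfData K :=
  @HopfData K (tens A H)
    (bicrossed_mul lact ract)
    (hone A ⊗ hone H)
    (fun u => \Sw_(a, x <- u) \Sw_(a1, a2 <- Δ a) \Sw_(x1, x2 <- Δ x)
       ((a1 ⊗ x1) ⊗ (a2 ⊗ x2)))
    (fun u => \sw_(a, x <- u) (ε a * ε x))
    (fun u => \Sw_(a, x <- u)
       bicrossed_mul lact ract (hone A ⊗ hantip x) (hantip a ⊗ hone H)).

(* (x ▷ α)(y) = \sum α(S^-1(x_2) y x_1) *)
Definition double_lact H (x : H) (a : hcop (hdual H)) : hcop (hdual H) :=
  lform (fun y : H => \sw_(x1, x2 <- Δ x) ev a (antip_inv x2 ∗ y ∗ x1)).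

(* x ◁ α = \sum α(S^-1(x_3) x_1) x_2 *)
Definition double_ract H (x : H) (a : hcop (hdual H)) : H :=
  \Sw_(x1, u <- Δ x) \Sw_(x2, x3 <- Δ u)
    (ev a (antip_inv x3 ∗ x1) *: x2).

Definition drinfeld_double H : hopfData K :=
  bicrossed (@double_lact H) (@double_ract H).

End Hopf.

(* Main.v *)
From HB Require Import structures.
Require Import Defs.
From mathcomp Require Import all_boot all_order all_algebra.

Set Implicit Arguments.
Unset Strict Implicit.
Unset Printing Implicit Defensive.

Import GRing.Theory.
Local Open Scope ring_scope.
Local Open Scope hopf_scope.

(** Let s be a Hopf automorphism of H with s² = S².  Then S² is bijective, hence
    so is the antipode S; write T for its inverse.

    The double is an algebra of functions: a ⊗ x, with a a form on H, is the map
    u |-> a(u) x from H to H ([dfun]), and this identifies D(H) with the linear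
    endomorphisms of H ([dfun_inj]).  In these terms, in Sweedler notation,
    - (f g)(u) = f(u_1)_2 g(T(f(u_1)_3) u_2 f(u_1)_1), the two actions of the
      matched pair having merged into one conjugation ([dfun_mul]);
    - the coproduct of f is (u, v) |-> Δ(f(v u)), a map from H x H to H ⊗ H
      ([sw_dfun_comul]), and its counit is ε(f(1)).
    A tensor over D(H) is determined by its values as a multilinear map
    ([double_tens_inj]), so every Hopf axiom for D(H) becomes an identity in H,
    which follows from coassociativity and from T reversing products and
    coproducts.  The antipode axioms reduce to those of the two factors, because
    a ⊗ x is the product of a ⊗ 1 and 1 ⊗ x ([double_hopf]).

    Since the antipode of D(H) reverses products, its square maps a ⊗ x to
    (a ∘ T²) ⊗ S² x; as an operation on functions it is f |-> S² ∘ f ∘ T²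
    ([double_antip_sqr]).  Conjugation f |-> s ∘ f ∘ s⁻¹ is a Hopf automorphism of
    D(H), because all the structure is written with that of H, and its square is
    f |-> S² ∘ f ∘ T² as well ([double_conj_aut], [double_conj_sqr]). *)

(** * Linear maps and Sweedler sums *)

Definition lin (K : fieldType) (V W : vectType K) (f : V -> W) : Prop :=
  linear f.

Section Linearity.
Variable K : fieldType.
Implicit Types V W U X : vectType K.

Lemma lin0 V W (f : V -> W) : lin f -> f 0 = 0.
Proof. by move=> Lf; have := Lf (-1) 0 0; rewrite scaler0 addr0 scaleN1r addNr. Qed.

Lemma linD V W (f : V -> W) x y : lin f -> f (x + y) = f x + f y.
Proof. by move=> Lf; have := Lf 1 x y; rewrite !scale1r. Qed.

Lemma linZ V W (f : V -> W) a x : lin f -> f (a *: x) = a *: f x.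
Proof. by move=> Lf; have := Lf a x 0; rewrite (lin0 Lf) !addr0. Qed.

Lemma lin_sum V W (f : V -> W) n (F : 'I_n -> V) :
  lin f -> f (\sum_i F i) = \sum_i f (F i).
Proof.
move=> Lf; elim/big_rec2: _ => [|i y1 y2 _ <-]; first exact: lin0.
exact: linD.
Qed.

Lemma lin_id V : lin (fun v : V => v).
Proof. by []. Qed.

Lemma lin_comp X V W (g : V -> W) (f : X -> V) :
  lin g -> lin f -> lin (fun x => g (f x)).
Proof. by move=> Lg Lf a u v; rewrite Lf Lg. Qed.

Lemma lin_tliftt X V W U (F : V -> W -> U) (t : X -> tens V W) :
  lin t -> lin (fun x => tlift F (t x)).
Proof. by move=> Lt a x y; rewrite Lt; apply: tlift_linear. Qed.

Lemma lin_tliftf X V W U (F : X -> V -> W -> U) (t : tens V W) :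
  (forall a b, lin (fun x => F x a b)) -> lin (fun x => tlift (F x) t).
Proof.
move=> LF a x y; rewrite /tlift scaler_sumr -big_split; apply: eq_bigr => i _.
rewrite scaler_sumr -big_split; apply: eq_bigr => j _ /=.
by rewrite (LF _ _ a x y) scalerDr !scalerA mulrC.
Qed.

Lemma lin_tformt X V W (F : V -> W -> K) (t : X -> tens V W) :
  lin t -> lin (fun x => tform F (t x) : K^o).
Proof. exact: lin_tliftt. Qed.

Lemma lin_tformf X V W (F : X -> V -> W -> K) (t : tens V W) :
  (forall a b, lin (fun x => F x a b : K^o)) ->
  lin (fun x => tform (F x) t : K^o).
Proof. exact: lin_tliftf. Qed.

Lemma lin_scalel X V (c : X -> K) (v : V) :
  lin (fun x => c x : K^o) -> lin (fun x => c x *: v).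
Proof. by move=> Lc a x y; rewrite Lc scalerDl scalerA. Qed.

Lemma lin_scaler X V (c : K) (f : X -> V) :
  lin f -> lin (fun x => c *: f x).
Proof. by move=> Lf a x y; rewrite Lf scalerDr !scalerA mulrC. Qed.

Lemma lin_mull X (c : X -> K) (k : K) :
  lin (fun x => c x : K^o) -> lin (fun x => c x * k : K^o).
Proof. exact: (@lin_scalel X K^o). Qed.

Lemma lin_mulr X (c : X -> K) (k : K) :
  lin (fun x => c x : K^o) -> lin (fun x => k * c x : K^o).
Proof. exact: (@lin_scaler X K^o). Qed.

Lemma lin_ev X V (a : vdual V) (f : X -> V) :
  lin f -> lin (fun x => ev a (f x) : K^o).
Proof. by move=> Lf c x y; rewrite Lf /ev linearP. Qed.

Lemma lin_evl X V (a : X -> vdual V) (v : V) :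
  lin a -> lin (fun x => ev (a x) v : K^o).
Proof. by move=> La c x y; rewrite La /ev add_lfunE scale_lfunE. Qed.

Lemma lin_crd X V i (f : X -> V) : lin f -> lin (fun x => crd i (f x) : K^o).
Proof. by move=> Lf c x y; rewrite Lf /crd linearP. Qed.

Lemma lin_ptensl X V W (f : X -> V) (w : W) : lin f -> lin (fun x => f x ⊗ w).
Proof.
move=> Lf c x y; rewrite Lf; apply/matrixP => i j.
by rewrite !mxE /crd linearP /= mulrDl mulrA.
Qed.

Lemma lin_ptensr X V W (v : V) (f : X -> W) : lin f -> lin (fun x => v ⊗ f x).
Proof.
move=> Lf c x y; rewrite Lf; apply/matrixP => i j.
by rewrite !mxE /crd linearP /= mulrDr mulrCA.
Qed.

Lemma linfunE V W (f : V -> W) v : lin f -> linfun f v = f v.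
Proof.
move=> Lf; pose fL := GRing.isLinear.Build K V W *:%R f Lf.
pose g : {linear V -> W} := HB.pack f fL.
exact: (lfunE g v).
Qed.

Lemma evE V (f : V -> K) v : lin (f : V -> K^o) -> ev (lform f) v = f v.
Proof. exact: linfunE. Qed.

End Linearity.

Section SweedlerSums.
Variable K : fieldType.
Implicit Types V W U X Y : vectType K.

Lemma tliftE V W U (f : V -> W -> U) (t : tens V W) :
  tlift f t = \sum_p (t : 'M_(_, _)) p.1 p.2 *: f (bas p.1) (bas p.2).
Proof. by rewrite /tlift pair_bigA. Qed.

Lemma eq_tlift V W U (f g : V -> W -> U) (t : tens V W) :
  (forall a b, f a b = g a b) -> tlift f t = tlift g t.
Proof.
by move=> fg; rewrite !tliftE; apply: eq_bigr => i _; rewrite fg.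
Qed.

Lemma lin_tlift V W U X (L : U -> X) (f : V -> W -> U) (t : tens V W) :
  lin L -> L (tlift f t) = tlift (fun a b => L (f a b)) t.
Proof.
move=> LL; rewrite /tlift lin_sum //; apply: eq_bigr => i _.
by rewrite lin_sum //; apply: eq_bigr => j _; rewrite linZ.
Qed.

Lemma tliftC V W U X Y (F : V -> W -> X -> Y -> U)
    (t : tens V W) (s : tens X Y) :
  \Sw_(a, b <- t) \Sw_(c, d <- s) F a b c d =
  \Sw_(c, d <- s) \Sw_(a, b <- t) F a b c d.
Proof.
rewrite !tliftE.
under eq_bigr => p _ do rewrite tliftE scaler_sumr.
under [RHS]eq_bigr => p _ do rewrite tliftE scaler_sumr.
rewrite exchange_big; apply: eq_bigr => p _; apply: eq_bigr => q _.
by rewrite !scalerA mulrC.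
Qed.

Lemma tform_scale V W U (f : V -> W -> K) (t : tens V W) (v : U) :
  (\sw_(a, b <- t) f a b) *: v = \Sw_(a, b <- t) (f a b *: v).
Proof.
exact: (@lin_tlift V W K^o U (fun c => c *: v) f t
          (lin_scalel v (@lin_id K K^o))).
Qed.

Lemma tlift_ptensE V W U (f : V -> W -> U) v w :
  (forall v, lin (f v)) -> (forall w, lin (fun v => f v w)) ->
  \Sw_(a, b <- v ⊗ w) f a b = f v w.
Proof. by move=> f1 f2; apply: tlift_ptens. Qed.

Lemma tens_ext V W U (f g : tens V W -> U) :
  lin f -> lin g -> (forall a b, f (a ⊗ b) = g (a ⊗ b)) -> f =1 g.
Proof.
move=> Lf Lg fg t; rewrite (tens_ind t) (lin_tlift _ _ Lf) (lin_tlift _ _ Lg).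
exact: eq_tlift.
Qed.

(** Expand [t] along a basis of [W], with coefficients [v c] in [V]: separation on
    [W] shows that every [F i] vanishes on each [v c], and separation on [V] that
    [v c] is zero. *)
Lemma tens_sep_scale V W Y (I J : Type) (F : I -> V -> K) (G : J -> W -> Y)
    (t : tens V W) :
  (forall i, lin (F i : V -> K^o)) -> (forall j, lin (G j)) ->
  (forall v, (forall i, F i v = 0) -> v = 0) ->
  (forall w, (forall j, G j w = 0) -> w = 0) ->
  (forall i j, \Sw_(a, b <- t) (F i a *: G j b) = 0) -> t = 0.
Proof.
move=> LF LG sepF sepG t0; apply/matrixP => r c; rewrite !mxE.
pose v c : V := \sum_r (t : 'M_(_, _)) r c *: bas r.
have free0 X n (B : n.-tuple X) (k : 'I_n -> K) :
    free B -> \sum_i k i *: B`_i = 0 -> forall i, k i = 0.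
  by move=> /freeP; apply.
have v0 : v c = 0.
  apply: sepF => i.
  suff w0 : \sum_c F i (v c) *: bas c = 0 :> W.
    by apply: (free0 _ _ (vbasis {:W}) (fun c => F i (v c)));
       rewrite ?(basis_free (vbasisP _)).
  apply: sepG => j; rewrite -[RHS](t0 i j) lin_sum // /tlift exchange_big.
  apply: eq_bigr => l _; rewrite linZ // (lin_sum _ (LF i)) scaler_suml.
  by apply: eq_bigr => k _; rewrite (linZ _ _ (LF i)) scalerA.
by apply: (free0 _ _ (vbasis {:V}) (fun r => (t : 'M_(_, _)) r c));
   rewrite ?(basis_free (vbasisP _)).
Qed.

Lemma crd_sep V (v : V) : (forall i, crd i v = 0) -> v = 0.
Proof. by move=> v0; rewrite (bas_crd v) big1 // => i _; rewrite v0 scale0r. Qed.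

Lemma tens_sep V W X Y (I J : Type) (F : I -> V -> X) (G : J -> W -> Y)
    (t : tens V W) :
  (forall i, lin (F i)) -> (forall j, lin (G j)) ->
  (forall v, (forall i, F i v = 0) -> v = 0) ->
  (forall w, (forall j, G j w = 0) -> w = 0) ->
  (forall i j, \Sw_(a, b <- t) (F i a ⊗ G j b) = 0) -> t = 0.
Proof.
move=> LF LG sepF sepG t0.
apply: (@tens_sep_scale V W Y (I * 'I_(\dim {:X})) J
          (fun k v => crd k.2 (F k.1 v)) G) => //.
- by case=> i k; apply: lin_crd.
- move=> v v0; apply: sepF => i; apply: crd_sep => k.
  exact: v0 (i, k).
case=> i k j /=.
pose L (s : tens X Y) : Y := \Sw_(x, y <- s) (crd k x *: y).
have LL : lin L by exact: (lin_tliftt _ (@lin_id _ _)).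
have := congr1 L (t0 i j); rewrite (lin0 LL) (lin_tlift _ _ LL) => <-.
apply: eq_tlift => a b; rewrite /L tlift_ptensE // => [v|w].
- exact: (lin_scaler _ (@lin_id _ _)).
- exact: (lin_scalel _ (lin_crd _ (@lin_id _ _))).
Qed.

End SweedlerSums.

(** [lin] goals are syntax directed: each variable of a Sweedler expression
    occurs exactly once in every summand, so linearity in it follows by walking
    down to its occurrence.  Each operation met on the way has to be linear by a
    hypothesis; only hypotheses that mention this very operation are tried, since
    comparing the operations of different Hopf algebras would unfold them. *)
Ltac lin_operation t :=
  lazymatch t with
  | ?g ?a =>
      let A := type of a in
      lazymatch A with
      | hopfData _ => t
      | GRing.Field.type => t
      | Vector.type _ => t
      | _ => lin_operation g
      end
  | _ => t
  end.

Ltac lin_hyp op :=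
  match goal with
  | B : bilinear_map op |- _ => first [exact (proj1 B _) | exact (proj2 B _)]
  | B : lin op |- _ => exact B
  | B : context [op] |- _ =>
      first [ exact B | exact (B _) | exact (B _ _) | exact (B _ _ _)
            | exact (B _ _ _ _) | exact (B _ _ _ _ _)
            | match goal with Lf : lin _ |- _ => exact (B _ _ Lf) end
            | match goal with C : _ |- _ => exact (B _ _ (C _)) end ]
  end.

Ltac lin_step :=
  cbv beta;
  lazymatch goal with
  | |- lin (fun x => x) => exact (@lin_id _ _)
  (* The next cases occur when unification has eta-reduced the function. *)
  | |- lin (tlift _) => exact (lin_tliftt _ (@lin_id _ _))
  | |- lin (ptens _) => exact (lin_ptensr _ (@lin_id _ _))
  | |- lin (crd _) => exact (lin_crd _ (@lin_id _ _))
  | |- lin (fun x => tlift _ _) =>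
      first [ refine (lin_tliftf _ _); do 2 (let y := fresh in intro y);
              lin_step
            | refine (lin_tliftt _ _); lin_step ]
  | |- lin (fun x => tform _ _) =>
      first [ refine (lin_tformf _ _); do 2 (let y := fresh in intro y);
              lin_step
            | refine (lin_tformt _ _); lin_step ]
  | |- lin (fun x => ev _ _) =>
      first [refine (lin_evl _ _) | refine (lin_ev _ _)]; lin_step
  | |- lin (fun x => ptens _ _) =>
      first [refine (lin_ptensl _ _) | refine (lin_ptensr _ _)]; lin_step
  | |- lin (fun x => GRing.scale _ _) =>
      first [refine (lin_scalel _ _) | refine (lin_scaler _ _)]; lin_step
  | |- lin (fun x => GRing.mul _ _) =>
      first [refine (lin_mull _ _) | refine (lin_mulr _ _)]; lin_step
  | |- lin (fun x => crd _ _) => refine (lin_crd _ _); lin_step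
  | |- lin (fun x => _) =>
      match goal with
      | |- @lin _ _ ?W (fun x => ?f (@?g x)) =>
          let op := lin_operation f in
          lazymatch g with
          | fun x => x => lin_hyp op
          | _ => refine (@lin_comp _ _ _ W f g _ _);
                 [lin_hyp op | lin_step]
          end
      | |- @lin _ _ ?W (fun x => ?f (@?g x) ?b) =>
          let op := lin_operation f in
          lazymatch g with
          | fun x => x => lin_hyp op
          | _ => refine (@lin_comp _ _ _ W (fun y => f y b) g _ _);
                 [lin_hyp op | lin_step]
          end
      | |- @lin _ _ ?W (fun x => ?f (@?g x) ?b ?c) =>
          let op := lin_operation f in
          lazymatch g with
          | fun x => x => lin_hyp op
          | _ => refine (@lin_comp _ _ _ W (fun y => f y b c) g _ _);
                 [lin_hyp op | lin_step]
          end
      | |- @lin _ _ ?W (fun x => ?f (@?g x) ?b ?c ?d) =>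
          let op := lin_operation f in
          lazymatch g with
          | fun x => x => lin_hyp op
          | _ => refine (@lin_comp _ _ _ W (fun y => f y b c d) g _ _);
                 [lin_hyp op | lin_step]
          end
      | |- @lin _ _ ?W (fun x => ?f (@?g x) ?b ?c ?d ?e) =>
          let op := lin_operation f in
          lazymatch g with
          | fun x => x => lin_hyp op
          | _ => refine (@lin_comp _ _ _ W (fun y => f y b c d e) g _ _);
                 [lin_hyp op | lin_step]
          end
      end
  | |- lin ?f => let op := lin_operation f in lin_hyp op
  end.
Ltac lin_tac := intros; lin_step.

(** * Calculus in a coalgebra *)

Section CoalgebraSums.
Variables (K : fieldType) (C : hopfData K).
Hypothesis hC : is_coalgebra C.
Variable U : vectType K.

Let lin_comul : lin (@hcomul K C) := hcomul_linear hC.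

Lemma sw_assoc (F : C -> C -> C -> U) x :
  (forall b c, lin (fun a => F a b c)) ->
  (forall a c, lin (fun b => F a b c)) ->
  (forall a b, lin (fun c => F a b c)) ->
  \Sw_(x1, u <- Δ x) \Sw_(x2, x3 <- Δ u) F x1 x2 x3 =
  \Sw_(u, x3 <- Δ x) \Sw_(x1, x2 <- Δ u) F x1 x2 x3.
Proof.
move=> F1 F2 F3.
pose L (t : tens C (tens C C)) := \Sw_(a, s <- t) \Sw_(b, c <- s) F a b c.
have LL : lin L by rewrite /L; lin_tac.
have LE a b c : L (a ⊗ (b ⊗ c)) = F a b c.
  by rewrite /L !tlift_ptensE //; lin_tac.
have := congr1 L (hcomulA hC x); rewrite !(lin_tlift _ _ LL) => E.
transitivity (\Sw_(x1, u <- Δ x) L (\Sw_(x2, x3 <- Δ u) (x1 ⊗ (x2 ⊗ x3)))).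
  apply: eq_tlift => x1 u; rewrite (lin_tlift _ _ LL).
  by apply: eq_tlift => x2 x3; rewrite LE.
rewrite E; apply: eq_tlift => x1 u; rewrite (lin_tlift _ _ LL).
by apply: eq_tlift => x2 x3; rewrite LE.
Qed.

Lemma sw_counitl (F : C -> U) x :
  lin F -> \Sw_(x1, x2 <- Δ x) (ε x1 *: F x2) = F x.
Proof.
move=> LF; rewrite -{2}(hcounitl hC x) (lin_tlift _ _ LF).
by apply: eq_tlift => a b; rewrite linZ.
Qed.

Lemma sw_counitr (F : C -> U) x :
  lin F -> \Sw_(x1, x2 <- Δ x) (ε x2 *: F x1) = F x.
Proof.
move=> LF; rewrite -{2}(hcounitr hC x) (lin_tlift _ _ LF).
by apply: eq_tlift => a b; rewrite linZ.
Qed.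

(** Two ways of splitting the fivefold coproduct: refining the outer factors of
    the threefold one, or refining its middle factor. *)
Lemma sw_assoc5 (F : C -> C -> C -> C -> C -> U) x :
  (forall b c d e, lin (fun a => F a b c d e)) ->
  (forall a c d e, lin (fun b => F a b c d e)) ->
  (forall a b d e, lin (fun c => F a b c d e)) ->
  (forall a b c e, lin (fun d => F a b c d e)) ->
  (forall a b c d, lin (fun e => F a b c d e)) ->
  \Sw_(x1, u <- Δ x) \Sw_(x2, x3 <- Δ u)
    \Sw_(a, b <- Δ x1) \Sw_(c, d <- Δ x3) F a b x2 c d =
  \Sw_(x1, u <- Δ x) \Sw_(x2, x3 <- Δ u)
    \Sw_(y1, v <- Δ x2) \Sw_(y2, y3 <- Δ v) F x1 y1 y2 y3 x3.
Proof.
move=> F1 F2 F3 F4 F5.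
under eq_tlift => x1 u do rewrite tliftC.
rewrite -sw_assoc //; try by lin_tac.
apply: eq_tlift => x1 u.
rewrite -[RHS]sw_assoc //; try by lin_tac.
apply: eq_tlift => x2 v.
by rewrite -[RHS]sw_assoc //; lin_tac.
Qed.

End CoalgebraSums.

(** * The antipode reverses products and coproducts *)

Section HopfAntipode.
Variables (K : fieldType) (L : hopfData K).
Hypothesis hL : is_hopf L.
Implicit Types (U : vectType K) (x y : L).

Let hB := hopf_bialgebra hL.
Let hC := hopf_coalgebra hB.
Let hA := hopf_algebra hB.
Let lin_comul : lin (@hcomul K L) := hcomul_linear hC.
Let lin_counit : lin (@hcounit K L : L -> K^o) := hcounit_linear hC.
Let lin_antip : lin (@hantip K L) := hantip_linear hL.
Let mul_bil : bilinear_map (@hmul K L) := hmul_bilinear hA.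

Lemma sw_mul U (F : L -> L -> U) x y :
  (forall b, lin (fun a => F a b)) -> (forall a, lin (fun b => F a b)) ->
  \Sw_(z1, z2 <- Δ (x ∗ y)) F z1 z2 =
  \Sw_(x1, x2 <- Δ x) \Sw_(y1, y2 <- Δ y) F (x1 ∗ y1) (x2 ∗ y2).
Proof.
move=> F1 F2; rewrite (hcomulM hB).
have LF : lin (tlift F) by lin_tac.
rewrite (lin_tlift _ _ LF); apply: eq_tlift => x1 x2.
rewrite (lin_tlift _ _ LF); apply: eq_tlift => y1 y2.
by rewrite tlift_ptensE.
Qed.

Lemma sw_one U (F : L -> L -> U) :
  (forall b, lin (fun a => F a b)) -> (forall a, lin (fun b => F a b)) ->
  \Sw_(z1, z2 <- Δ (hone L)) F z1 z2 = F (hone L) (hone L).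
Proof. by move=> F1 F2; rewrite (hcomul1 hB) tlift_ptensE. Qed.

Lemma sw_antipl U (F : L -> U) x :
  lin F -> \Sw_(x1, x2 <- Δ x) F (hantip x1 ∗ x2) = ε x *: F (hone L).
Proof.
by move=> LF; rewrite -(lin_tlift _ _ LF) (hantipl hL) linZ.
Qed.

Lemma sw_antipr U (F : L -> U) x :
  lin F -> \Sw_(x1, x2 <- Δ x) F (x1 ∗ hantip x2) = ε x *: F (hone L).
Proof.
by move=> LF; rewrite -(lin_tlift _ _ LF) (hantipr hL) linZ.
Qed.

Lemma antip1 : hantip (hone L) = hone L.
Proof.
have := hantipl hL (hone L); rewrite sw_one; try by lin_tac.
by rewrite (hmul1r hA) (hcounit1 hB) scale1r.
Qed.

Lemma counit_antip (x : L) : ε (hantip x) = ε x.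
Proof.
have Le : lin (@hcounit K L : L -> K^o) by [].
have := congr1 (@hcounit K L : L -> K^o) (hantipl hL x).
rewrite (lin_tlift _ _ Le) (linZ _ _ Le) (hcounit1 hB) => E.
have -> : ε x = ε x *: (1 : K^o) :> K^o by rewrite [RHS]mulr1.
rewrite -E -(sw_counitr (U := K^o) hC (F := fun x : L => ε (hantip x)));
  last by lin_tac.
apply: (@eq_tlift K L L K^o) => a b.
by rewrite (hcounitM hB) mulrC.
Qed.

(** Both sides are convolution inverse to the product, viewed as a map
    [L ⊗ L -> L]: inserting [x_2 y_2 S(y_3) S(x_3)] between [S(x_1 y_1)] and the
    unit and cancelling on the left gives [S(y) S(x)]. *)
Lemma antipM (x y : L) : hantip (x ∗ y) = hantip y ∗ hantip x.
Proof.
pose G x1 x2 x3 y1 y2 y3 : L :=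
  hantip (x1 ∗ y1) ∗ ((x2 ∗ y2) ∗ (hantip y3 ∗ hantip x3)).
have K1 F u v : lin F -> \Sw_(x2, x3 <- Δ u) \Sw_(y2, y3 <- Δ v)
    (F ((x2 ∗ y2) ∗ (hantip y3 ∗ hantip x3)) : L) = (ε u * ε v) *: F (hone L).
  move=> LF; rewrite -scalerA -(sw_antipr (F := fun z => ε v *: F z)); last by lin_tac.
  apply: eq_tlift => x2 x3; rewrite -{2}[x2](hmul1r hA).
  rewrite -(sw_antipr (F := fun z => F ((x2 ∗ z) ∗ hantip x3))); last by lin_tac.
  by apply: eq_tlift => y2 y3; rewrite !(hmulA hA).
transitivity (\Sw_(x1, u <- Δ x) \Sw_(y1, v <- Δ y)
    \Sw_(x2, x3 <- Δ u) \Sw_(y2, y3 <- Δ v) G x1 x2 x3 y1 y2 y3).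
  (* Both counits are split off from the left side, then expanded by [K1]. *)
  rewrite -{1}(sw_counitr hC (F := fun x => hantip (x ∗ y))); last by lin_tac.
  apply: eq_tlift => x1 u.
  rewrite -(sw_counitr hC (F := fun y => ε u *: hantip (x1 ∗ y))); last by lin_tac.
  apply: eq_tlift => y1 v; rewrite scalerA mulrC K1; last by lin_tac.
  by rewrite (hmul1r hA).
under eq_tlift => x1 u do rewrite tliftC.
rewrite sw_assoc //; try by rewrite /G; lin_tac.
transitivity (\Sw_(u, x3 <- Δ x) \Sw_(v, y3 <- Δ y)
   (ε (u ∗ v) *: (hantip y3 ∗ hantip x3))).
  apply: eq_tlift => u x3.
  under eq_tlift => x1 x2 do (rewrite (sw_assoc hC); try by rewrite /G; lin_tac).
  rewrite tliftC; apply: eq_tlift => v y3.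
  rewrite -[hantip y3 ∗ _](hmul1l hA).
  rewrite -(sw_antipl (F := fun z => z ∗ (hantip y3 ∗ hantip x3))); last by lin_tac.
  rewrite sw_mul; try by lin_tac.
  by apply: eq_tlift => x1 x2; apply: eq_tlift => y1 y2; rewrite /G !(hmulA hA).
rewrite -(sw_counitl hC (F := fun x => hantip y ∗ hantip x)); last by lin_tac.
apply: eq_tlift => u x3.
rewrite -(sw_counitl hC (F := fun y => ε u *: (hantip y ∗ hantip x3)));
  last by lin_tac.
by apply: eq_tlift => v y3; rewrite (hcounitM hB) scalerA mulrC.
Qed.

Let tmul (s t : tens L L) : tens L L :=
  \Sw_(a, b <- s) \Sw_(c, d <- t) ((a ∗ c) ⊗ (b ∗ d)).

Let tmul_linl t : lin (fun s => tmul s t).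
Proof. by rewrite /tmul; lin_tac. Qed.

Let tmul_linr s : lin (fun t => tmul s t).
Proof. by rewrite /tmul; lin_tac. Qed.

Let tmul_pure a b c d : tmul (a ⊗ b) (c ⊗ d) = (a ∗ c) ⊗ (b ∗ d).
Proof. by rewrite /tmul !tlift_ptensE //; lin_tac. Qed.

Let tmulA r s t : tmul r (tmul s t) = tmul (tmul r s) t.
Proof.
apply: (tens_ext (f := fun r => tmul r (tmul s t))
                 (g := fun r => tmul (tmul r s) t)); try by lin_tac.
move=> a b; apply: (tens_ext (f := fun s => tmul _ (tmul s t))
                             (g := fun s => tmul (tmul _ s) t)); try by lin_tac.
move=> c d; apply: (tens_ext (f := fun t => tmul _ (tmul _ t))
                             (g := fun t => tmul _ t)); try by lin_tac.
by move=> e f; rewrite !tmul_pure !(hmulA hA).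
Qed.

Let tmul1 t : tmul t (hone L ⊗ hone L) = t.
Proof.
apply: (tens_ext (f := fun t => tmul t _) (g := fun t => t)); try by lin_tac.
by move=> a b; rewrite tmul_pure !(hmul1r hA).
Qed.

Let tmul1l t : tmul (hone L ⊗ hone L) t = t.
Proof.
apply: (tens_ext (f := fun t => tmul _ t) (g := fun t => t)); try by lin_tac.
by move=> a b; rewrite tmul_pure !(hmul1l hA).
Qed.

Let comulM (x y : L) : Δ (x ∗ y) = tmul (Δ x) (Δ y).
Proof. exact: hcomulM. Qed.

(** Both sides are convolution inverse to the coproduct [L -> L ⊗ L], for the
    componentwise product of [L ⊗ L]. *)
Lemma comul_antip (x : L) :
  Δ (hantip x) = \Sw_(x1, x2 <- Δ x) (hantip x2 ⊗ hantip x1).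
Proof.
pose R (u : L) : tens L L := \Sw_(u1, u2 <- Δ u) (hantip u2 ⊗ hantip u1).
have LR : lin R by rewrite /R; lin_tac.
have KR u : \Sw_(u1, u2 <- Δ u) tmul (Δ u1) (R u2) = ε u *: (hone L ⊗ hone L).
  transitivity (\Sw_(u1, v <- Δ u) \Sw_(u2, w <- Δ v) \Sw_(u3, u4 <- Δ w)
     ((u1 ∗ hantip u4) ⊗ (u2 ∗ hantip u3))).
    rewrite sw_assoc //; try by lin_tac.
    apply: eq_tlift => u1 u2; rewrite /tmul /R; apply: eq_tlift => a b.
    rewrite (lin_tlift (L := fun t => \Sw_(c, d <- t) _)); last by lin_tac.
    by apply: eq_tlift => c d; rewrite tlift_ptensE //; lin_tac.
  rewrite -(sw_antipr (F := fun z => z ⊗ hone L)); last by lin_tac.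
  apply: eq_tlift => u1 v; rewrite sw_assoc //; try by lin_tac.
  rewrite -(sw_counitl hC (F := fun z => (u1 ∗ hantip z) ⊗ hone L));
    last by lin_tac.
  apply: eq_tlift => w u4.
  by rewrite -(sw_antipr (F := fun z => (u1 ∗ hantip u4) ⊗ z)) //; lin_tac.
rewrite -/(R x) -(sw_counitl hC (F := R)) //.
transitivity (\Sw_(x1, u <- Δ x) \Sw_(x2, x3 <- Δ u)
   tmul (Δ (hantip x1)) (tmul (Δ x2) (R x3))).
  rewrite -{1}(sw_counitr hC (F := fun x => Δ (hantip x))); last by lin_tac.
  apply: eq_tlift => x1 u.
  rewrite -(lin_tlift (L := fun z => tmul _ z)) ?KR; last by lin_tac.
  by rewrite (linZ (f := fun z => tmul _ z)) ?tmul1 //; lin_tac.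
rewrite sw_assoc //; try by lin_tac.
apply: eq_tlift => u x3.
under eq_tlift => x1 x2 do rewrite tmulA -comulM.
rewrite (sw_antipl (F := fun z => tmul (Δ z) (R x3))); last by lin_tac.
by rewrite (hcomul1 hB) tmul1l.
Qed.

Lemma sw_antip U (F : L -> L -> U) (x : L) :
  (forall b, lin (fun a => F a b)) -> (forall a, lin (fun b => F a b)) ->
  \Sw_(a, b <- Δ (hantip x)) F a b =
  \Sw_(x1, x2 <- Δ x) F (hantip x2) (hantip x1).
Proof.
move=> F1 F2; have LF : lin (tlift F) by lin_tac.
rewrite comul_antip (lin_tlift _ _ LF).
by apply: eq_tlift => a b; rewrite tlift_ptensE.
Qed.

End HopfAntipode.

(** * The inverse of the antipode *)

Lemma antip_inv_lin (K : fieldType) (L : hopfData K) : lin (@antip_inv K L).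
Proof. by move=> a x y; rewrite /antip_inv linearP. Qed.

Lemma antip_inv_cancel (K : fieldType) (L : hopfData K) :
  lin (@hantip K L) -> injective (@hantip K L) ->
  cancel (@hantip K L) (@antip_inv K L) /\
  cancel (@antip_inv K L) (@hantip K L).
Proof.
move=> Ls inj; have ker0 : lker (linfun (@hantip K L)) == 0%VS.
  by apply/lker0P => x y; rewrite !linfunE //; apply: inj.
split=> x; rewrite -[hantip _](linfunE _ Ls); first exact: lker0_lfunK.
exact: lker0_lfunVK.
Qed.

Section InverseAntipode.
Variables (K : fieldType) (H : hopfData K).
Hypothesis hH : is_hopf H.
Hypothesis antip_bij : bijective (@hantip K H).
Implicit Types (U : vectType K) (x y u : H).

Let hB := hopf_bialgebra hH.
Let hC := hopf_coalgebra hB.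
Let hA := hopf_algebra hB.
Let lin_antip : lin (@hantip K H) := hantip_linear hH.
Let mul_bil : bilinear_map (@hmul K H) := hmul_bilinear hA.

Local Notation T := (@antip_inv K H).

Lemma antipK : cancel (@hantip K H) T.
Proof. exact: (antip_inv_cancel lin_antip (bij_inj antip_bij)).1. Qed.

Lemma antip_invK : cancel T (@hantip K H).
Proof. exact: (antip_inv_cancel lin_antip (bij_inj antip_bij)).2. Qed.

Let lin_antip_inv := @antip_inv_lin K H.
Let antip_inj : injective (@hantip K H) := bij_inj antip_bij.

Lemma antip_invM x y : T (x ∗ y) = T y ∗ T x.
Proof. by apply: antip_inj; rewrite (antipM hH) !antip_invK. Qed.

Lemma antip_inv1 : T (hone H) = hone H.
Proof. by apply: antip_inj; rewrite antip_invK (antip1 hH). Qed.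

Lemma counit_antip_inv x : ε (T x) = ε x.
Proof. by rewrite -(counit_antip hH) antip_invK. Qed.

Lemma sw_antip_inv U (F : H -> H -> U) x :
  (forall b, lin (fun a => F a b)) -> (forall a, lin (fun b => F a b)) ->
  \Sw_(a, b <- Δ (T x)) F a b = \Sw_(x1, x2 <- Δ x) F (T x2) (T x1).
Proof.
move=> F1 F2; rewrite -{2}[x]antip_invK.
rewrite (sw_antip hH (F := fun a b => F (T b) (T a))); try by lin_tac.
by apply: eq_tlift => a b; rewrite !antipK.
Qed.

(** [T] is an antipode for the opposite coproduct, which is why the two Sweedler
    factors appear in the reverse order in this lemma and the next. *)
Lemma sw_antip_invl U (F : H -> U) x :
  lin F -> \Sw_(x1, x2 <- Δ x) F (T x2 ∗ x1) = ε x *: F (hone H).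
Proof.
move=> LF; rewrite -counit_antip_inv -{1}[x]antip_invK.
rewrite (sw_antip hH (F := fun a b => F (T b ∗ a))); try by lin_tac.
rewrite -(sw_antipr hH (F := F)) //.
by apply: eq_tlift => a b; rewrite antipK.
Qed.

Lemma sw_antip_invr U (F : H -> U) x :
  lin F -> \Sw_(x1, x2 <- Δ x) F (x2 ∗ T x1) = ε x *: F (hone H).
Proof.
move=> LF; rewrite -counit_antip_inv -{1}[x]antip_invK.
rewrite (sw_antip hH (F := fun a b => F (b ∗ T a))); try by lin_tac.
rewrite -(sw_antipl hH (F := F)) //.
by apply: eq_tlift => a b; rewrite antipK.
Qed.

End InverseAntipode.

(** * Evaluating the coproduct of the dual *)

Section DualPairing.
Variables (K : fieldType) (H : hopfData K).
Local Notation A := (hcop (hdual H)).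

Lemma sw_dual_comul (U : vectType K) (F : A -> A -> U) (a : A) :
  (forall b, lin (fun a => F a b)) -> (forall a, lin (fun b => F a b)) ->
  \Sw_(a1, a2 <- Δ a) F a1 a2 =
  \sum_i \sum_j ev a (bas i ∗ bas j) *:
     F (lform (@crd K H j)) (lform (@crd K H i)).
Proof.
move=> F1 F2; have LF : lin (tlift F) by lin_tac.
rewrite /= (lin_tlift _ _ LF).
rewrite (lin_sum _ (lin_tliftt _ (@lin_id _ _))); apply: eq_bigr => i _.
rewrite (lin_sum _ (lin_tliftt _ (@lin_id _ _))); apply: eq_bigr => j _.
rewrite (linZ _ _ (lin_tliftt _ (@lin_id _ _))) !tlift_ptensE //; lin_tac.
Qed.

(** The order of [y] and [x] on the right is that of [hcop]. *)
Lemma dual_comul (U : vectType K) (a : A) (x y : H) (v : U) :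
  bilinear_map (@hmul K H) ->
  \Sw_(a1, a2 <- Δ a) ((ev a1 x * ev a2 y) *: v) = ev a (y ∗ x) *: v.
Proof.
move=> Bm; rewrite sw_dual_comul; try by lin_tac.
have La : lin (fun x => ev a x : K^o) by lin_tac.
rewrite {2}(bas_crd y) (lin_sum (f := fun y => y ∗ x)) ?(lin_sum _ La);
  last by lin_tac.
rewrite scaler_suml; apply: eq_bigr => i _.
rewrite {2}(bas_crd x) (lin_sum (f := fun x => _ ∗ x)) ?(lin_sum _ La);
  last by lin_tac.
rewrite scaler_suml; apply: eq_bigr => j _.
rewrite (linZ (f := fun x => _ ∗ x)) ?(linZ _ _ La); last by lin_tac.
rewrite (linZ (f := fun y => y ∗ _)) ?(linZ _ _ La); last by lin_tac.
rewrite !evE; try by lin_tac.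
by rewrite scalerA; congr (_ *: v); rewrite mulrC -mulrA.
Qed.

End DualPairing.

(** * The double as an algebra of functions *)

Lemma lin_sep_inj (K : fieldType) (V W : vectType K) (I : Type)
    (f : I -> V -> W) :
  (forall i, lin (f i)) -> (forall v, (forall i, f i v = 0) -> v = 0) ->
  forall s t, (forall i, f i s = f i t) -> s = t.
Proof.
move=> Lf sep s t st; apply/eqP; rewrite -subr_eq0; apply/eqP; apply: sep => i.
by rewrite linD // -scaleN1r linZ // st scaleN1r subrr.
Qed.

Section DrinfeldDouble.
Variables (K : fieldType) (H : hopfData K).
Hypothesis hH : is_hopf H.
Hypothesis antip_bij : bijective (@hantip K H).
Implicit Types (U : vectType K) (x y p u v w : H) (f g : H -> H).

Let hB := hopf_bialgebra hH.
Let hC := hopf_coalgebra hB.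
Let hA := hopf_algebra hB.
Let lin_comul : lin (@hcomul K H) := hcomul_linear hC.
Let lin_counit : lin (@hcounit K H : H -> K^o) := hcounit_linear hC.
Let lin_antip : lin (@hantip K H) := hantip_linear hH.
Let lin_antip_inv := @antip_inv_lin K H.
Let mul_bil : bilinear_map (@hmul K H) := hmul_bilinear hA.

Local Notation T := (@antip_inv K H).
Local Notation A := (hcop (hdual H)).
Local Notation D := (drinfeld_double H).

(** The canonical map from [H^* ⊗ H] to the endomorphisms of [H]. *)
Definition dfun (t : D) u : H := \Sw_(a, x <- t) (ev a u *: x).

(** Left multiplication by [1 ⊗ p] in the double, on functions. *)
Definition dact p f u : H :=
  \Sw_(p1, r <- Δ p) \Sw_(p2, p3 <- Δ r) (p2 ∗ f (T p3 ∗ u ∗ p1)).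

Lemma dfun_lin t : lin (dfun t).
Proof. by rewrite /dfun; lin_tac. Qed.

Lemma dfun_linl u : lin (fun t => dfun t u).
Proof. by rewrite /dfun; lin_tac. Qed.

(* Linearity facts are restated as local hypotheses, where [lin_tac] looks. *)
Let dfun_lin' := dfun_lin.
Let dfun_linl' := dfun_linl.

Lemma dact_linp f u : lin (fun p => dact p f u).
Proof. by rewrite /dact; lin_tac. Qed.

Lemma dact_linu p f : lin f -> lin (dact p f).
Proof. by move=> Lf; rewrite /dact; lin_tac. Qed.

Let dact_linp' := dact_linp.
Let dact_linu' := dact_linu.

Lemma dfun_pure (a : A) x u : dfun (a ⊗ x) u = ev a u *: x.
Proof. by rewrite /dfun tlift_ptensE //; lin_tac. Qed.

(** The forms [ev _ u] separate the points of the dual, and the identity those of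
    [H]. *)
Lemma dfun_inj (s t : D) : (forall u, dfun s u = dfun t u) -> s = t.
Proof.
move=> st; apply: lin_sep_inj dfun_linl' _ _ _ st => r r0.
apply: (@tens_sep_scale K A H H H unit (fun u a => ev a u) (fun _ x => x)).
- by move=> u; lin_tac.
- by move=> _; lin_tac.
- by move=> a a0; apply/lfunP => u; rewrite lfunE; apply: a0.
- by move=> x; apply.
- by move=> u _; apply: r0.
Qed.

Lemma double_mul_bil : bilinear_map (@hmul K D).
Proof.
split=> t.
  by change (lin (fun s : D => t ∗ s)); rewrite /= /bicrossed_mul; lin_tac.
by change (lin (fun s : D => s ∗ t)); rewrite /= /bicrossed_mul; lin_tac.
Qed.

Let double_mul_bil' := double_mul_bil.

Lemma ev_lact x (b : A) w :
  ev (double_lact x b) w = \sw_(x1, x2 <- Δ x) ev b (T x2 ∗ w ∗ x1).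
Proof. by rewrite evE //; lin_tac. Qed.

Lemma ev_dual_mul (a b : A) w :
  ev (a ∗ b) w = \sw_(w1, w2 <- Δ w) (ev a w1 * ev b w2).
Proof. by rewrite evE //; lin_tac. Qed.

(** The product of the double involves [b(T(x_5) x_3 T(x_2) u x_1)] and [x_4]; the
    factor [x_3 T(x_2)] contributes a counit, which leaves [dact]. *)
Lemma dfun_mul (s t : D) u :
  dfun (s ∗ t) u = \Sw_(u1, u2 <- Δ u) dact (dfun s u1) (dfun t) u2.
Proof.
have Lu := dfun_linl u.
have -> : s ∗ t = \Sw_(a, x <- s) \Sw_(b, y <- t) \Sw_(x1, x2 <- Δ x)
    \Sw_(b1, b2 <- Δ (b : A))
    (((a : A) ∗ double_lact x1 b1) ⊗ (double_ract x2 b2 ∗ y)) by [].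
rewrite (lin_tlift _ _ Lu).
transitivity (\Sw_(u1, u2 <- Δ u) \Sw_(a, x <- s)
   (ev a u1 *: dact x (dfun t) u2)); last first.
  apply: eq_tlift => u1 u2.
  rewrite (lin_tlift (L := fun p => dact p (dfun t) u2)) //.
  by apply: eq_tlift => a x; rewrite (linZ _ _ (dact_linp' _ _)).
rewrite [RHS]tliftC; apply: eq_tlift => a x.
rewrite (lin_tlift _ _ Lu).
transitivity (\Sw_(b, y <- t) \Sw_(u1, u2 <- Δ u)
   (ev a u1 *: dact x (fun w => ev b w *: y) u2)); last first.
  rewrite tliftC; apply: eq_tlift => u1 u2.
  rewrite -(lin_tlift (L := fun z => ev a u1 *: z)); last by lin_tac.
  congr (_ *: _); rewrite /dact tliftC; apply: eq_tlift => p1 r.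
  rewrite tliftC; apply: eq_tlift => p2 p3.
  by rewrite -(lin_tlift (L := fun z => p2 ∗ z)); last by lin_tac.
apply: eq_tlift => b y; rewrite (lin_tlift _ _ Lu).
pose G u1 u2 x1 x2 y1 y2 y3 :=
  ev a u1 *: (ev b ((T y3 ∗ y1) ∗ (T x2 ∗ u2 ∗ x1)) *: (y2 ∗ y)).
transitivity (\Sw_(x1, x2 <- Δ x) \Sw_(u1, u2 <- Δ u) \Sw_(x11, x12 <- Δ x1)
    \Sw_(y1, w <- Δ x2) \Sw_(y2, y3 <- Δ w) G u1 u2 x11 x12 y1 y2 y3).
  apply: eq_tlift => x1 x2; rewrite (lin_tlift _ _ Lu).
  transitivity (\Sw_(b1, b2 <- Δ b) \Sw_(u1, u2 <- Δ u)
      \Sw_(x11, x12 <- Δ x1) \Sw_(y1, w <- Δ x2) \Sw_(y2, y3 <- Δ w)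
      (ev a u1 *: ((ev b1 (T x12 ∗ u2 ∗ x11) * ev b2 (T y3 ∗ y1)) *: (y2 ∗ y)))).
    apply: eq_tlift => b1 b2; rewrite dfun_pure ev_dual_mul tform_scale.
    apply: eq_tlift => u1 u2; rewrite ev_lact -scalerA tform_scale.
    rewrite (lin_tlift (L := fun z => ev a u1 *: z)); last by lin_tac.
    apply: eq_tlift => x11 x12; rewrite /double_ract.
    have Ly : lin (fun z => ev a u1 *: (ev b1 (T x12 ∗ u2 ∗ x11) *: (z ∗ y))).
      by lin_tac.
    rewrite (lin_tlift _ _ Ly); apply: eq_tlift => y1 w.
    rewrite (lin_tlift _ _ Ly); apply: eq_tlift => y2 y3.
    rewrite -scalerA (linZ (f := fun z => z ∗ y)) //; lin_tac.
  rewrite tliftC; apply: eq_tlift => u1 u2.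
  rewrite tliftC; apply: eq_tlift => x11 x12.
  rewrite tliftC; apply: eq_tlift => y1 w.
  rewrite tliftC; apply: eq_tlift => y2 y3.
  rewrite -(lin_tlift (L := fun z => ev a u1 *: z)); last by lin_tac.
  by rewrite dual_comul.
rewrite tliftC; apply: eq_tlift => u1 u2.
rewrite -sw_assoc //; try by rewrite /G; lin_tac.
rewrite /dact (lin_tlift (L := fun z => ev a u1 *: z)); last by lin_tac.
apply: eq_tlift => x11 m; rewrite sw_assoc //; try by rewrite /G; lin_tac.
rewrite -(sw_counitl hC (F := fun m => ev a u1 *: \Sw_(p2, p3 <- Δ m)
   (p2 ∗ (ev b (T p3 ∗ u2 ∗ x11) *: y)))); last by lin_tac.
apply: eq_tlift => n w.
pose F z := \Sw_(y2, y3 <- Δ w)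
  (ev a u1 *: (ev b (T y3 ∗ (z ∗ (u2 ∗ x11))) *: (y2 ∗ y))).
transitivity (ε n *: F (hone H)); last first.
  congr (_ *: _); rewrite /F (lin_tlift (L := fun z => ev a u1 *: z));
    last by lin_tac.
  apply: eq_tlift => y2 y3; rewrite (linZ (f := fun y => y2 ∗ y));
    last by lin_tac.
  by rewrite (hmul1l hA) !(hmulA hA).
rewrite -(sw_antip_invr hH antip_bij (F := F)); last by rewrite /F; lin_tac.
apply: eq_tlift => x12 y1; apply: eq_tlift => y2 y3.
by rewrite /G !(hmulA hA).
Qed.

(** * The bialgebra axioms *)

(** Associativity, for a left factor in [H]. *)
Lemma dact_dact x y g u :
  lin g -> dact (x ∗ y) g u = dact x (dact y g) u.
Proof.
move=> Lg; rewrite /dact (sw_mul hH); try by lin_tac.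
apply: eq_tlift => x1 x'.
under eq_tlift => y1 y' do (rewrite (sw_mul hH); try by lin_tac).
rewrite tliftC; apply: eq_tlift => x2 x3.
rewrite (lin_tlift (L := fun z => x2 ∗ z)); last by lin_tac.
apply: eq_tlift => y1 y'.
rewrite (lin_tlift (L := fun z => x2 ∗ z)); last by lin_tac.
apply: eq_tlift => y2 y3.
by rewrite (antip_invM hH antip_bij) !(hmulA hA).
Qed.

(** Associativity, for a left factor in [H] and arbitrary functions as the other
    two: both sides are
    [p_3 dact (f(T(p_5) u_1 p_1)) g (T(p_4) u_2 p_2)]. *)
Lemma dact_mul p f g u : lin f -> lin g ->
  dact p (fun w => \Sw_(w1, w2 <- Δ w) dact (f w1) g w2) u =
  \Sw_(u1, u2 <- Δ u) dact (dact p f u1) g u2.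
Proof.
move=> Lf Lg.
pose F p1 a b c p3 := \Sw_(u1, u2 <- Δ u)
  (b ∗ dact (f (T p3 ∗ u1 ∗ p1)) g (T c ∗ u2 ∗ a)).
transitivity (\Sw_(x1, r <- Δ p) \Sw_(x2, x3 <- Δ r)
  \Sw_(a, b <- Δ x1) \Sw_(c, d <- Δ x3) F a b x2 c d).
  apply: eq_tlift => p1 r; apply: eq_tlift => p2 p3.
  rewrite (sw_mul hH); try by lin_tac.
  rewrite tliftC (lin_tlift (L := fun z => p2 ∗ z)); last by lin_tac.
  apply: eq_tlift => a b; rewrite (sw_mul hH); try by lin_tac.
  rewrite (sw_antip_inv hH antip_bij); try by lin_tac.
  rewrite (lin_tlift (L := fun z => p2 ∗ z)); last by lin_tac.
  apply: eq_tlift => c d.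
  by rewrite (lin_tlift (L := fun z => p2 ∗ z)); last by lin_tac.

rewrite (sw_assoc5 hC (F := F)); try by rewrite /F; lin_tac.
rewrite {2}/dact.
under [RHS]eq_tlift => u1 u2 do
  rewrite (lin_tlift (L := fun z => dact z g u2)) //.
rewrite [RHS]tliftC; apply: eq_tlift => p1 r.
under [RHS]eq_tlift => u1 u2 do
  rewrite (lin_tlift (L := fun z => dact z g u2)) //.
rewrite [RHS]tliftC; apply: eq_tlift => p2 p3.
under [RHS]eq_tlift => u1 u2 do rewrite dact_dact // {1}/dact.
rewrite [RHS]tliftC; apply: eq_tlift => a m.
by rewrite [RHS]tliftC; apply: eq_tlift => b c.
Qed.

Lemma double_mulA (s t r : D) : s ∗ (t ∗ r) = (s ∗ t) ∗ r.
Proof.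
apply: dfun_inj => u; rewrite !dfun_mul.
transitivity (\Sw_(u1, v <- Δ u) \Sw_(u2, u3 <- Δ v)
  dact (dact (dfun s u1) (dfun t) u2) (dfun r) u3).
  apply: eq_tlift => u1 v; rewrite -dact_mul //; apply: eq_tlift => p1 m.
  by apply: eq_tlift => p2 p3; rewrite dfun_mul.
rewrite sw_assoc //; try by lin_tac.
apply: eq_tlift => v u3; rewrite dfun_mul.
by rewrite (lin_tlift (L := fun z => dact z (dfun r) u3)).
Qed.

Lemma dact1 f u : lin f -> dact (hone H) f u = f u.
Proof.
move=> Lf; rewrite /dact (sw_one hH); try by lin_tac.
rewrite (sw_one hH); try by lin_tac.
by rewrite (antip_inv1 hH antip_bij) !(hmul1l hA) (hmul1r hA).
Qed.

Lemma dact_counit p y u : dact p (fun w => ε w *: y) u = ε u *: (p ∗ y).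
Proof.
rewrite /dact -(sw_counitl hC (F := fun p => ε u *: (p ∗ y))); last by lin_tac.
apply: eq_tlift => p1 r.
rewrite -(sw_counitr hC (F := fun r => ε p1 *: (ε u *: (r ∗ y))));
  last by lin_tac.
apply: eq_tlift => p2 p3; rewrite !(hcounitM hB) (counit_antip_inv hH antip_bij).
rewrite (linZ (f := fun z => p2 ∗ z)); last by lin_tac.
by rewrite !scalerA mulrAC.
Qed.

Lemma dfun_one u : dfun (hone D) u = ε u *: hone H.
Proof. by rewrite dfun_pure evE. Qed.

Lemma double_mul1l (t : D) : hone D ∗ t = t.
Proof.
apply: dfun_inj => u; rewrite dfun_mul -(sw_counitl hC (F := dfun t)) //.
apply: eq_tlift => u1 u2; rewrite dfun_one.
by rewrite (linZ (f := fun p => dact p (dfun t) u2)) // dact1.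
Qed.

Lemma double_mul1r (t : D) : t ∗ hone D = t.
Proof.
apply: dfun_inj => u; rewrite dfun_mul -[RHS](sw_counitr hC (F := dfun t)) //.
apply: eq_tlift => u1 u2; rewrite -[dfun t u1 in RHS](hmul1r hA) -dact_counit.
by apply: eq_tlift => p1 r; apply: eq_tlift => p2 p3; rewrite dfun_one.
Qed.

Lemma double_algebra : is_algebra D.
Proof.
split; [exact: double_mul_bil | exact: double_mulA | exact: double_mul1l
       | exact: double_mul1r].
Qed.

Lemma double_comul_lin : lin (@hcomul K D).
Proof. by rewrite /=; lin_tac. Qed.

Lemma sw_double_comul U (F : D -> D -> U) (t : D) :
  (forall r, lin (fun s => F s r)) -> (forall s, lin (fun r => F s r)) ->
  \Sw_(s, r <- Δ t) F s r =
  \Sw_(a, x <- t) \Sw_(a1, a2 <- Δ (a : A)) \Sw_(x1, x2 <- Δ x)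
     F (a1 ⊗ x1) (a2 ⊗ x2).
Proof.
move=> F1 F2; have LF : lin (tlift F) by lin_tac.
have -> : Δ t = \Sw_(a, x <- t) \Sw_(a1, a2 <- Δ (a : A)) \Sw_(x1, x2 <- Δ x)
   (((a1 ⊗ x1) : D) ⊗ ((a2 ⊗ x2) : D)) by [].
rewrite (lin_tlift _ _ LF); apply: eq_tlift => a x.
rewrite (lin_tlift _ _ LF); apply: eq_tlift => a1 a2.
rewrite (lin_tlift _ _ LF); apply: eq_tlift => x1 x2.
by rewrite tlift_ptensE.
Qed.

(** On functions, the coproduct of [t] at [(u, v)] is that of the value of [t] at
    [v u]: the coproduct of the dual evaluates a form at a product, in the order
    of [hcop]. *)
Lemma sw_dfun_comul U (F : H -> H -> U) (t : D) u v :
  (forall b, lin (fun a => F a b)) -> (forall a, lin (fun b => F a b)) ->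
  \Sw_(s, r <- Δ t) F (dfun s u) (dfun r v) =
  \Sw_(x1, x2 <- Δ (dfun t (v ∗ u))) F x1 x2.
Proof.
move=> F1 F2; rewrite sw_double_comul; try by lin_tac.
rewrite /dfun (lin_tlift (L := fun z => \Sw_(x1, x2 <- Δ z) F x1 x2));
  last by lin_tac.
apply: eq_tlift => a x.
rewrite (linZ (f := fun z => \Sw_(x1, x2 <- Δ z) F x1 x2)); last by lin_tac.
rewrite -dual_comul //; apply: eq_tlift => a1 a2.
rewrite (lin_tlift (L := fun z => _ *: z)); last by lin_tac.
apply: eq_tlift => x1 x2; rewrite -!/(dfun _ _) !dfun_pure.
rewrite (linZ (f := fun z => F z _)) //.
by rewrite (linZ (f := fun z => F _ z)) // scalerA.
Qed.

Lemma dfun_sep (t : D) : (forall u, dfun t u = 0) -> t = 0.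
Proof.
by move=> t0; apply: dfun_inj => u; rewrite t0 (lin0 (dfun_linl' u)).
Qed.

Let dfun2 (uv : H * H) (X : tens D D) : tens H H :=
  \Sw_(s, r <- X) (dfun s uv.1 ⊗ dfun r uv.2).

Let dfun2_lin uv : lin (dfun2 uv).
Proof. exact: (lin_tliftt _ (@lin_id _ _)). Qed.

Let dfun2_sep (X : tens D D) : (forall uv, dfun2 uv X = 0) -> X = 0.
Proof.
move=> X0.
apply: (@tens_sep K D D H H H H (fun u s => dfun s u) (fun v s => dfun s v)).
- exact: dfun_linl'.
- exact: dfun_linl'.
- exact: dfun_sep.
- exact: dfun_sep.
by move=> u v; apply: (X0 (u, v)).
Qed.

Lemma double_tens_inj (X Y : tens D D) :
  (forall u v, \Sw_(s, r <- X) (dfun s u ⊗ dfun r v) =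
               \Sw_(s, r <- Y) (dfun s u ⊗ dfun r v)) -> X = Y.
Proof.
move=> XY; apply: (lin_sep_inj dfun2_lin dfun2_sep).
by case=> u v; apply: XY.
Qed.

Let dfun3 (uvw : H * (H * H)) (X : tens D (tens D D)) : tens H (tens H H) :=
  \Sw_(s, Y <- X) (dfun s uvw.1 ⊗ dfun2 uvw.2 Y).

Let dfun3_lin uvw : lin (dfun3 uvw).
Proof. exact: (lin_tliftt _ (@lin_id _ _)). Qed.

Let dfun3_pure u v w s r q :
  dfun3 (u, (v, w)) (s ⊗ (r ⊗ q)) = dfun s u ⊗ (dfun r v ⊗ dfun q w).
Proof.
rewrite /dfun3 tlift_ptensE; try by lin_tac.
by rewrite /dfun2 tlift_ptensE //; lin_tac.
Qed.

Let dfun3_sep (X : tens D (tens D D)) : (forall uvw, dfun3 uvw X = 0) -> X = 0.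
Proof.
move=> X0.
apply: (@tens_sep K D (tens D D) H (tens H H) H (H * H)
          (fun u s => dfun s u) dfun2).
- exact: dfun_linl'.
- exact: dfun2_lin.
- exact: dfun_sep.
- exact: dfun2_sep.
by move=> u vw; apply: (X0 (u, vw)).
Qed.

Lemma double_comulA (t : D) :
  \Sw_(x1, u <- Δ t) \Sw_(x2, x3 <- Δ u) (x1 ⊗ (x2 ⊗ x3)) =
  \Sw_(u, x3 <- Δ t) \Sw_(x1, x2 <- Δ u) (x1 ⊗ (x2 ⊗ x3)).
Proof.
apply: (lin_sep_inj dfun3_lin dfun3_sep) => -[u [v w]].
have LL := dfun3_lin (u, (v, w)).
rewrite !(lin_tlift _ _ LL).
transitivity (\Sw_(c, d <- Δ (dfun t ((w ∗ v) ∗ u))) \Sw_(a, b <- Δ d)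
   (c ⊗ (a ⊗ b))).
  rewrite -sw_dfun_comul; try by lin_tac.
  apply: eq_tlift => s q; rewrite (lin_tlift _ _ LL) -sw_dfun_comul;
    try by lin_tac.
  by apply: eq_tlift => r p; apply: dfun3_pure.
rewrite -(hmulA hA) sw_assoc //; try by lin_tac.
rewrite -sw_dfun_comul; try by lin_tac.
apply: eq_tlift => q p; rewrite (lin_tlift _ _ LL) -sw_dfun_comul;
  try by lin_tac.
by apply: eq_tlift => r s; rewrite dfun3_pure.
Qed.

Lemma double_counitE (t : D) : ε t = ε (dfun t (hone H)).
Proof.
rewrite /dfun (lin_tlift (L := (@hcounit K H : H -> K^o))) //.
apply: (@eq_tlift K A H K^o) => a x.
by rewrite (linZ (f := (@hcounit K H : H -> K^o))).
Qed.

Lemma double_coalgebra : is_coalgebra D.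
Proof.
split.
- exact: double_comul_lin.
- by change (lin (@hcounit K D : D -> K^o)); rewrite /=; lin_tac.
- exact: double_comulA.
- move=> t; apply: dfun_inj => u.
  rewrite (lin_tlift _ _ (dfun_linl' u)).
  rewrite -[RHS](sw_counitl hC (F := fun x : H => x)) // -{2}[u](hmul1r hA).
  rewrite -(sw_dfun_comul (F := fun a b => ε a *: b)); try by lin_tac.
  by apply: eq_tlift => s r; rewrite double_counitE (linZ _ _ (dfun_linl' u)).
- move=> t; apply: dfun_inj => u.
  rewrite (lin_tlift _ _ (dfun_linl' u)).
  rewrite -[RHS](sw_counitr hC (F := fun x : H => x)) // -{2}[u](hmul1l hA).
  rewrite -(sw_dfun_comul (F := fun a b => ε b *: a)); try by lin_tac.
  by apply: eq_tlift => s r; rewrite double_counitE (linZ _ _ (dfun_linl' u)).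
Qed.

(** The coproduct is multiplicative when the left factor is in [H].  Expanding the
    left side into [w_1], ..., [w_6], the factors [w_3] and [w_4] meet in
    [w_4 T(w_3)], which contributes a counit. *)
Lemma dact_comul w (t : D) u v :
  \Sw_(p, q <- Δ w) \Sw_(t1, t2 <- Δ t)
     (dact p (dfun t1) u ⊗ dact q (dfun t2) v) =
  Δ (dact w (dfun t) (v ∗ u)).
Proof.
pose M p1 p2 z q2 q3 := \Sw_(z1, z2 <- Δ (dfun t (T q3 ∗ v ∗ z ∗ u ∗ p1)))
  ((p2 ∗ z1) ⊗ (q2 ∗ z2)).
transitivity (\Sw_(p, q <- Δ w) \Sw_(p1, r <- Δ p) \Sw_(p2, p3 <- Δ r)
   \Sw_(q1, s <- Δ q) \Sw_(q2, q3 <- Δ s) M p1 p2 (q1 ∗ T p3) q2 q3).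
  apply: eq_tlift => p q.
  transitivity (\Sw_(t1, t2 <- Δ t) \Sw_(p1, r <- Δ p) \Sw_(p2, p3 <- Δ r)
   \Sw_(q1, s <- Δ q) \Sw_(q2, q3 <- Δ s)
   ((p2 ∗ dfun t1 (T p3 ∗ u ∗ p1)) ⊗ (q2 ∗ dfun t2 (T q3 ∗ v ∗ q1)))).
    apply: eq_tlift => t1 t2.
    rewrite {1}/dact (lin_tlift (L := fun z => z ⊗ _)); last by lin_tac.
    apply: eq_tlift => p1 r.
    rewrite (lin_tlift (L := fun z => z ⊗ _)); last by lin_tac.
    apply: eq_tlift => p2 p3.
    rewrite /dact (lin_tlift (L := fun z => _ ⊗ z)); last by lin_tac.
    apply: eq_tlift => q1 s.
    by rewrite (lin_tlift (L := fun z => _ ⊗ z)); last by lin_tac.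
  rewrite tliftC; apply: eq_tlift => p1 r.
  rewrite tliftC; apply: eq_tlift => p2 p3.
  rewrite tliftC; apply: eq_tlift => q1 s.
  rewrite tliftC; apply: eq_tlift => q2 q3.
  rewrite (sw_dfun_comul (F := fun z1 z2 => (p2 ∗ z1) ⊗ (q2 ∗ z2)));
    try by lin_tac.
  by rewrite /M !(hmulA hA).
rewrite -sw_assoc //; try by rewrite /M; lin_tac.
rewrite /dact (lin_tlift _ _ lin_comul); apply: eq_tlift => p1 m.
rewrite (lin_tlift _ _ lin_comul).
rewrite -sw_assoc //; try by rewrite /M; lin_tac.
transitivity (\Sw_(p2, n <- Δ m) \Sw_(q2, q3 <- Δ n) M p1 p2 (hone H) q2 q3).
  apply: eq_tlift => p2 n.
  rewrite sw_assoc //; try by rewrite /M; lin_tac.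
  rewrite -[RHS](sw_counitl hC
    (F := fun n => \Sw_(q2, q3 <- Δ n) M p1 p2 (hone H) q2 q3));
    last by rewrite /M; lin_tac.
  apply: eq_tlift => k s.
  rewrite -(sw_antip_invr hH antip_bij
    (F := fun z => \Sw_(q2, q3 <- Δ s) M p1 p2 z q2 q3)) //.
  by rewrite /M; lin_tac.
rewrite sw_assoc //; try by rewrite /M; lin_tac.
apply: eq_tlift => l q3; rewrite (hcomulM hB); apply: eq_tlift => p2 q2.
by rewrite /M (hmul1r hA) !(hmulA hA).
Qed.

Lemma double_comulM (s t : D) :
  Δ (s ∗ t) =
  \Sw_(s1, s2 <- Δ s) \Sw_(t1, t2 <- Δ t) ((s1 ∗ t1) ⊗ (s2 ∗ t2)).
Proof.
apply: double_tens_inj => u v.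
rewrite sw_dfun_comul; try by lin_tac.
rewrite -tens_ind dfun_mul (sw_mul hH); try by lin_tac.
have LL : lin (tlift (fun a b : D => dfun a u ⊗ dfun b v)) by lin_tac.
rewrite (lin_tlift _ _ LL).
under [RHS]eq_tlift => s1 s2 do rewrite (lin_tlift _ _ LL).
transitivity (\Sw_(v1, v2 <- Δ v) \Sw_(u1, u2 <- Δ u)
   \Sw_(s1, s2 <- Δ s) \Sw_(t1, t2 <- Δ t)
   (dact (dfun s1 u1) (dfun t1) u2 ⊗ dact (dfun s2 v1) (dfun t2) v2)).
  rewrite (lin_tlift _ _ lin_comul); apply: eq_tlift => v1 v2.
  rewrite (lin_tlift _ _ lin_comul); apply: eq_tlift => u1 u2.
  rewrite -dact_comul -(sw_dfun_comul (F := fun p q => \Sw_(t1, t2 <- Δ t)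
     (dact p (dfun t1) u2 ⊗ dact q (dfun t2) v2))) //; lin_tac.
under eq_tlift => v1 v2 do rewrite tliftC.
rewrite tliftC; apply: eq_tlift => s1 s2.
under eq_tlift => v1 v2 do rewrite tliftC.
rewrite tliftC; apply: eq_tlift => t1 t2.
rewrite tlift_ptensE; try by lin_tac.
rewrite tliftC !dfun_mul (lin_tlift (L := fun z => z ⊗ _)); last by lin_tac.
apply: eq_tlift => u1 u2.
by rewrite (lin_tlift (L := fun z => _ ⊗ z)); last by lin_tac.
Qed.

Lemma double_bialgebra : is_bialgebra D.
Proof.
split.
- exact: double_algebra.
- exact: double_coalgebra.
- exact: double_comulM.
- apply: double_tens_inj => u v.
  rewrite sw_dfun_comul; try by lin_tac.
  rewrite -tens_ind tlift_ptensE; try by lin_tac.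
  rewrite !dfun_one.
  have -> a : Δ (a *: hone H) = a *: (hone H ⊗ hone H).
    by rewrite (linZ _ _ lin_comul) (hcomul1 hB).
  rewrite (linZ (f := fun z => z ⊗ _)); last by lin_tac.
  rewrite (linZ (f := fun z => _ ⊗ z)); last by lin_tac.
  by rewrite scalerA (hcounitM hB) mulrC.
- move=> s t; rewrite !double_counitE dfun_mul (sw_one hH); try by lin_tac.
  have Le : lin (@hcounit K H : H -> K^o) by [].
  rewrite /dact (lin_tlift _ _ Le).
  transitivity (\Sw_(p1, r <- Δ (dfun s (hone H)))
     (ε (dfun t (T r ∗ p1)) : K^o)); last first.
    rewrite (sw_antip_invl hH antip_bij
      (F := fun z => ε (dfun t z) : K^o)) //; lin_tac.
  apply: (@eq_tlift K H H K^o) => p1 r; rewrite (lin_tlift _ _ Le).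
  rewrite -(sw_counitl hC (F := fun z => ε (dfun t (T z ∗ p1)) : K^o));
    last by lin_tac.
  apply: (@eq_tlift K H H K^o) => p2 p3.
  by rewrite (hcounitM hB) (hmul1r hA).
- by rewrite double_counitE dfun_one (linZ _ _ lin_counit) (hcounit1 hB)
            scale1r.
Qed.

(** * The antipode *)

Let ldual (a : A) : D := a ⊗ hone H.
Let rbase x : D := hone A ⊗ x.

Let ldual_lin : lin ldual.
Proof. by rewrite /ldual; lin_tac. Qed.

Let rbase_lin : lin rbase.
Proof. by rewrite /rbase; lin_tac. Qed.

Let dual_antip_lin : lin (@hantip K A) := @antip_inv_lin K (hdual H).

Lemma ev_dual_antip (a : A) u : ev (hantip a) u = ev a (T u).
Proof.
have SE (b : hdual H) y : ev (hantip b : hdual H) y = ev b (hantip y).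
  by rewrite evE //; lin_tac.
have Ls : lin (@hantip K (hdual H)).
  move=> c b b'; apply/lfunP => x.
  have evl y := lin_evl y (@lin_id K (vdual H)) c.
  by rewrite -!/(ev _ _) evl !SE -evl.
have inj : injective (@hantip K (hdual H)).
  move=> b b' bb'; apply/lfunP => x; rewrite -[x](antip_invK hH antip_bij).
  by rewrite -!/(ev _ _) -!SE bb'.
rewrite -[in LHS](antip_invK hH antip_bij u) -SE.
by rewrite (antip_inv_cancel Ls inj).2.
Qed.

Let dfun_ldual (a : A) u : dfun (ldual a) u = ev a u *: hone H.
Proof. exact: dfun_pure. Qed.

Let dfun_rbase x u : dfun (rbase x) u = ε u *: x.
Proof. by rewrite /rbase dfun_pure evE. Qed.

Let dfun_mul_rbase (t : D) y u : dfun (t ∗ rbase y) u = dfun t u ∗ y.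
Proof.
rewrite dfun_mul -(sw_counitr hC (F := fun u => dfun t u ∗ y)); last by lin_tac.
apply: eq_tlift => u1 u2; rewrite -dact_counit.
by apply: eq_tlift => p1 r; apply: eq_tlift => p2 p3; rewrite dfun_rbase.
Qed.

Let dfun_ldual_mul (a : A) (t : D) u :
  dfun (ldual a ∗ t) u = \Sw_(u1, u2 <- Δ u) (ev a u1 *: dfun t u2).
Proof.
rewrite dfun_mul; apply: eq_tlift => u1 u2; rewrite dfun_ldual.
by rewrite (linZ (f := fun p => dact p _ _)) // dact1.
Qed.

Let ldual_rbase (a : A) x : ldual a ∗ rbase x = a ⊗ x.
Proof.
apply: dfun_inj => u; rewrite dfun_mul_rbase dfun_ldual dfun_pure.
by rewrite (linZ (f := fun z => z ∗ x)) ?(hmul1l hA) //; lin_tac.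
Qed.

Let rbaseM x y : rbase x ∗ rbase y = rbase (x ∗ y).
Proof.
apply: dfun_inj => u; rewrite dfun_mul_rbase !dfun_rbase.
by rewrite (linZ (f := fun z => z ∗ y)) //; lin_tac.
Qed.

Lemma double_antip_pure (a : A) x :
  hantip (a ⊗ x : D) =
  ((hone A ⊗ hantip x) : D) ∗ ((hantip a ⊗ hone H) : D).
Proof.
have -> : hantip (a ⊗ x : D) =
   \Sw_(a, x <- a ⊗ x) (rbase (hantip x) ∗ ldual (hantip (a : A))) by [].
by rewrite tlift_ptensE //; lin_tac.
Qed.

Let double_antipE (a : A) x :
  hantip (a ⊗ x : D) = rbase (hantip x) ∗ ldual (hantip a).
Proof. exact: double_antip_pure. Qed.

Lemma double_antip_lin : lin (@hantip K D).
Proof. exact: (lin_tliftt _ (@lin_id _ _)). Qed.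
Let double_antip_lin' := double_antip_lin.

Let dual_antipl (a : A) :
  \Sw_(a1, a2 <- Δ a) (ldual (hantip a1) ∗ ldual a2) =
  ev a (hone H) *: hone D.
Proof.
apply: dfun_inj => u; rewrite (lin_tlift _ _ (dfun_linl' u)).
rewrite (linZ _ _ (dfun_linl' u)) dfun_one scalerA mulrC -scalerA.
rewrite -(sw_antip_invr hH antip_bij (F := fun z => ev a z *: hone H));
  last by lin_tac.
transitivity (\Sw_(a1, a2 <- Δ a) \Sw_(u1, u2 <- Δ u)
   ((ev a1 (T u1) * ev a2 u2) *: hone H)).
  apply: eq_tlift => a1 a2; rewrite dfun_ldual_mul; apply: eq_tlift => u1 u2.
  by rewrite dfun_ldual ev_dual_antip scalerA.
by rewrite tliftC; apply: eq_tlift => u1 u2; rewrite dual_comul.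
Qed.

Let dual_antipr (a : A) :
  \Sw_(a1, a2 <- Δ a) (ldual a1 ∗ ldual (hantip a2)) =
  ev a (hone H) *: hone D.
Proof.
apply: dfun_inj => u; rewrite (lin_tlift _ _ (dfun_linl' u)).
rewrite (linZ _ _ (dfun_linl' u)) dfun_one scalerA mulrC -scalerA.
rewrite -(sw_antip_invl hH antip_bij (F := fun z => ev a z *: hone H));
  last by lin_tac.
transitivity (\Sw_(a1, a2 <- Δ a) \Sw_(u1, u2 <- Δ u)
   ((ev a1 u1 * ev a2 (T u2)) *: hone H)).
  apply: eq_tlift => a1 a2; rewrite dfun_ldual_mul; apply: eq_tlift => u1 u2.
  by rewrite dfun_ldual ev_dual_antip scalerA.
by rewrite tliftC; apply: eq_tlift => u1 u2; rewrite dual_comul.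
Qed.

Lemma double_hopf : is_hopf D.
Proof.
split; [exact: double_bialgebra | exact: double_antip_lin | |] => t.
- rewrite sw_double_comul; try by lin_tac.
  rewrite [ε t]/= tform_scale; apply: eq_tlift => a x; rewrite tliftC.
  rewrite mulrC -scalerA -[hone D]/(rbase (hone H)).
  rewrite -(sw_antipl hH (F := fun z => ev a (hone H) *: rbase z)) //;
    last by lin_tac.
  apply: eq_tlift => x1 x2.
  transitivity (\Sw_(a1, a2 <- Δ a) (rbase (hantip x1) ∗
      ((ldual (hantip a1) ∗ ldual a2) ∗ rbase x2))).
    apply: eq_tlift => a1 a2.
    by rewrite double_antipE -ldual_rbase !(hmulA double_algebra).
  rewrite -(lin_tlift (L := fun z => rbase (hantip x1) ∗ (z ∗ rbase x2)));
    last by lin_tac.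
  rewrite dual_antipl (linZ (f := fun z => _ ∗ (z ∗ rbase x2)));
    last by lin_tac.
  by rewrite (hmul1l double_algebra) rbaseM.
- rewrite sw_double_comul; try by lin_tac.
  rewrite [ε t]/= tform_scale; apply: eq_tlift => a x.
  transitivity (\Sw_(a1, a2 <- Δ a) \Sw_(x1, x2 <- Δ x)
      ((ldual a1 ∗ rbase (x1 ∗ hantip x2)) ∗ ldual (hantip a2))).
    apply: eq_tlift => a1 a2; apply: eq_tlift => x1 x2.
    by rewrite double_antipE -ldual_rbase -rbaseM !(hmulA double_algebra).
  rewrite mulrC -scalerA -dual_antipr (lin_tlift (L := fun z => _ *: z));
    last by lin_tac.
  apply: eq_tlift => a1 a2.
  rewrite (sw_antipr hH (F := fun z => (ldual a1 ∗ rbase z) ∗ _)) //;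
    last by lin_tac.
  by rewrite -[rbase (hone H)]/(hone D) (hmul1r double_algebra).
Qed.

(** The antipode of the double reverses products and restricts to those of the two
    factors, so its square is the tensor product of theirs; on functions this is
    composition with [S^2] on one side and with [T^2] on the other. *)
Lemma double_antip_sqr (t : D) u :
  dfun (hantip (hantip t)) u = hantip (hantip (dfun t (T (T u)))).
Proof.
move: t; apply: tens_ext; try by lin_tac.
move=> a x; rewrite double_antipE (antipM double_hopf).
have -> y : hantip (rbase y) = rbase (hantip y).
  rewrite /rbase double_antipE; have -> : hantip (hone A) = hone A.
    apply/lfunP => w; rewrite -!/(ev _ _) ev_dual_antip !evE //.
    by rewrite (counit_antip_inv hH).
  exact: (hmul1r double_algebra).
have -> b : hantip (ldual b) = ldual (hantip b).
  by rewrite /ldual double_antipE (antip1 hH); apply: (hmul1l double_algebra).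
rewrite ldual_rbase !dfun_pure !ev_dual_antip.
by rewrite !(linZ _ _ lin_antip).
Qed.

(** * Conjugation by an automorphism *)

Section Conjugation.
Variables (s r : H -> H).
Hypothesis s_aut : is_hopf_automorphism s.
Hypothesis sK : cancel s r.
Hypothesis rK : cancel r s.

Let lin_s : lin s := haut_linear s_aut.

Let s_inj : injective s := can_inj sK.

Let lin_r : lin r.
Proof. by move=> a x y; apply: s_inj; rewrite lin_s !rK. Qed.

Let rM x y : r (x ∗ y) = r x ∗ r y.
Proof. by apply: s_inj; rewrite (hautM s_aut) !rK. Qed.

Let r1 : r (hone H) = hone H.
Proof. by apply: s_inj; rewrite (haut1 s_aut) rK. Qed.

Let r_counit x : ε (r x) = ε x.
Proof. by rewrite -(haut_counit s_aut) rK. Qed.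

Let s_antip_inv x : s (T x) = T (s x).
Proof.
apply: (bij_inj antip_bij).
by rewrite -(haut_antip s_aut) !(antip_invK hH antip_bij).
Qed.

Let r_antip_inv x : r (T x) = T (r x).
Proof. by apply: s_inj; rewrite s_antip_inv !rK. Qed.

Let sw_aut U (F : H -> H -> U) x :
  (forall b, lin (fun a => F a b)) -> (forall a, lin (fun b => F a b)) ->
  \Sw_(a, b <- Δ (s x)) F a b = \Sw_(x1, x2 <- Δ x) F (s x1) (s x2).
Proof.
move=> F1 F2; have LF : lin (tlift F) by lin_tac.
rewrite (haut_comul s_aut) (lin_tlift _ _ LF).
by apply: eq_tlift => a b; rewrite tlift_ptensE.
Qed.

(** [h |-> f ∘ h ∘ g] on functions. *)
Definition double_conj f g (t : D) : D :=
  \Sw_(a, x <- t) ((lform (fun u => ev a (g u)) : A) ⊗ f x).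

Let double_conj_lin f g : lin (double_conj f g).
Proof. exact: (lin_tliftt _ (@lin_id _ _)). Qed.

Let dfun_conj f g (t : D) u : lin f -> lin g ->
  dfun (double_conj f g t) u = f (dfun t (g u)).
Proof.
move=> Lf Lg; rewrite /double_conj (lin_tlift _ _ (dfun_linl' u)).
rewrite {2}/dfun (lin_tlift _ _ Lf); apply: eq_tlift => a x.
by rewrite dfun_pure evE ?linZ //; lin_tac.
Qed.

Let dact_aut p f v : lin f ->
  s (dact p f v) = dact (s p) (fun w => s (f (r w))) (s v).
Proof.
move=> Lf; rewrite /dact sw_aut; try by lin_tac.
rewrite (lin_tlift _ _ lin_s); apply: eq_tlift => p1 m.
rewrite sw_aut; try by lin_tac.
rewrite (lin_tlift _ _ lin_s); apply: eq_tlift => p2 p3.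
by rewrite (hautM s_aut) !rM r_antip_inv !sK.
Qed.

Local Notation sD := (double_conj s r).

Let sD_lin : lin sD := double_conj_lin s r.

Let sDM (t q : D) : sD (t ∗ q) = sD t ∗ sD q.
Proof.
apply: dfun_inj => u; rewrite dfun_conj // !dfun_mul -{2}[u]rK.
rewrite sw_aut; try by lin_tac.
rewrite (lin_tlift _ _ lin_s); apply: eq_tlift => u1 u2.
rewrite dact_aut // dfun_conj // sK.
by apply: eq_tlift => p1 m; apply: eq_tlift => p2 p3; rewrite dfun_conj.
Qed.

Let sD_antip (t : D) : sD (hantip t) = hantip (sD t).
Proof.
move: t; apply: (@tens_ext K A H D (fun t : D => sD (hantip t))
                                   (fun t : D => hantip (sD t))); try by lin_tac.
move=> a x.
have -> : sD (a ⊗ x) = (lform (fun u => ev a (r u)) : A) ⊗ s x.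
  apply: dfun_inj => u; rewrite dfun_conj // !dfun_pure linZ // evE //.
  by lin_tac.
rewrite !double_antip_pure sDM; congr (_ ∗ _); apply: dfun_inj => u.
  rewrite dfun_conj // !dfun_pure linZ // !evE // r_counit.
  by rewrite (haut_antip s_aut).
rewrite dfun_conj // !dfun_pure linZ // (haut1 s_aut).
by rewrite !ev_dual_antip evE ?r_antip_inv //; lin_tac.
Qed.

Lemma double_conj_aut : is_hopf_automorphism sD.
Proof.
split.
- exact: sD_lin.
- exists (double_conj r s) => t; apply: dfun_inj => u;
    by rewrite !dfun_conj // ?sK ?rK.
- exact: sDM.
- apply: dfun_inj => u; rewrite dfun_conj // !dfun_one linZ //.
  by rewrite r_counit (haut1 s_aut).
- move=> t; apply: double_tens_inj => u v.
  have LF : lin (fun X : tens D D => \Sw_(a, b <- X) (dfun a u ⊗ dfun b v)).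
    exact: (lin_tliftt _ (@lin_id _ _)).
  rewrite (lin_tlift _ _ LF).
  rewrite sw_dfun_comul; try by lin_tac.
  rewrite dfun_conj // sw_aut; try by lin_tac.
  rewrite rM -(sw_dfun_comul (F := fun a b => s a ⊗ s b)); try by lin_tac.
  apply: eq_tlift => a b; rewrite tlift_ptensE; try by lin_tac.
  by rewrite !dfun_conj.
- move=> t; rewrite !double_counitE dfun_conj // r1.
  exact: (haut_counit s_aut).
- exact: sD_antip.
Qed.

Lemma double_conj_sqr :
  (forall x, s (s x) = hantip (hantip x)) ->
  forall t : D, sD (sD t) = hantip (hantip t).
Proof.
move=> s2 t; apply: dfun_inj => u; rewrite double_antip_sqr.
rewrite !dfun_conj // s2; congr (hantip (hantip (dfun t _))).
by apply: s_inj; apply: s_inj; rewrite !rK s2 !(antip_invK hH antip_bij).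
Qed.

End Conjugation.

End DrinfeldDouble.

(** * Almost involutive doubles *)

Lemma antip_bij_of_sqr (K : fieldType) (H : hopfData K) (s : H -> H) :
  bijective s -> (forall x, s (s x) = hantip (hantip x)) ->
  bijective (@hantip K H).
Proof.
case=> r sK rK s2.
have inj : injective (@hantip K H).
  by move=> x y xy; apply: (can_inj sK); apply: (can_inj sK); rewrite !s2 xy.
have can : cancel (fun y => hantip (r (r y))) (@hantip K H).
  by move=> y; rewrite -s2 !rK.
by exists (fun y => hantip (r (r y))) => // x; apply: inj; rewrite can.
Qed.

Theorem mainTheorem5 (K : closedFieldType) (charK : [pchar K] =i pred0)
  (H : hopfData K) (hopfH : is_hopf H) :
  almost_involutive H -> almost_involutive (drinfeld_double H).
Proof.
case=> _ [s s_aut s2].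
have antip_bij := antip_bij_of_sqr (haut_bijective s_aut) s2.
split; first exact: double_hopf.
have [r sK rK] := haut_bijective s_aut.
exists (double_conj s r); first exact: double_conj_aut.
exact: double_conj_sqr.
Qed.
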